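(* Assume that (i) for each $i=1,\dots,N$ the cost $c^i:\mathbb{R}_+\times\mathbb{R}_+\to\mathbb{R}_+$ is continuous, convex and strictly increasing in the first variable and measurable in the second variable, $c^i(0,\cdot)\equiv 0$ and $\lim_{q\to 0^+}c^i(q,\cdot)/q>0$; and (ii) $r^e>0$ for each $e\in E$. Let $\nu\in\mathcal{U}_G$. Then the problem $(P_\nu)$ has at least one solution. Moreover, a feasible pair $(\tilde q,\tilde\phi)$ of $(P_\nu)$ is an optimal solution of $(P_\nu)$ if and only if $$\lambda\otimes\mathbb{P}\left[(\tilde q,\tilde\phi)=(q^\star,\phi^\star)(Q^\nu,D^\nu)\right]=1 .$$ Finally, the optimal value $V_\nu$ of $(P_\nu)$ satisfies $$V_\nu=\mathbb{E}\left[\int_0^T\sum_{i=1}^N c^i\big(q^{\star,i}(Q^\nu_s,D^\nu_s),Q^{\nu,i}_s\big)\,\mathrm{d}s\right].$$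
   Context: Network. There are nodes $\{1,\dots,N\}$ and a finite set of edges $E=\{e_1,\dots,e_M\}$, $N,M\ge 1$; each edge connects two distinct nodes. $K_i$ is the set of edges connected to node $i$; for $e\in K_i$, $sgn(e,i)\in\{+1,-1\}$ encodes an arbitrarily fixed direction of $e$ (opposite signs at the two ends of $e$). Each edge $e$ has resistance $r^e\ge 0$ and flow limits $\underline\phi^e\le 0\le\overline\phi^e$: flow can be sent in both directions, $\phi^e>0$ being the default direction and $\phi^e<0$ the opposite one. Vector intervals such as $[0,Q]$ and $[\underline\phi,\overline\phi]$ are understood componentwise. Day-ahead problem. For $(Q,D)\in\mathbb{R}^N_+\times\mathbb{R}^N_+$, the problem $(DAP)$ is to minimize $\sum_{i=1}^N c^i(q^i,Q^i)$ over $(q,\phi)\in\mathbb{R}^N\times\mathbb{R}^M$ subject to $q^i+\sum_{e\in K_i}sgn(e,i)\phi^e\ge D^i+\sum_{e\in K_i}\frac{r^e}{2}(\phi^e)^2$ for $i=1,\dots,N$, $q\in[0,Q]$, $\phi\in[\underline\phi,\overline\phi]$. Define $$G(Q,D)=\max_{(q,\phi)\in[0,Q]\times[\underline\phi,\overline\phi]}\ \min_{i=1,\dots,N}\ q^i-D^i+\sum_{e\in K_i}\Big(sgn(e,i)\phi^e-\tfrac{r^e}{2}(\phi^e)^2\Big),$$ and $K=\{(Q,D)\in\mathbb{R}^N_+\times\mathbb{R}^N_+: G(Q,D)\ge 0\}$, which is the set of $(Q,D)$ for which $(DAP)$ is feasible. For $(Q,D)\in K$, $(q^\star,\phi^\star)(Q,D)$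 denotes the unique solution of $(DAP)$ (under (i)-(ii) it exists and is unique); it is extended to $(Q,D)\notin K$ in an arbitrary measurable way, e.g. by $0$. Stochastic setting. $(\Omega,\mathcal{F},\mathbb{P},\mathbb{F})$ is a filtered probability space, $T>0$, $U\subseteq\mathbb{R}^k$ is compact, $\mathcal{U}$ is the set of $U$-valued predictable processes (controls). For each $\nu\in\mathcal{U}$ there is given a pair of $\mathbb{F}$-predictable, $\mathbb{R}^N_+\times\mathbb{R}^N_+$-valued processes $(Q^\nu_s,D^\nu_s)_{s\in[0,T]}$ (capacity and demand). $\mathcal{U}_G$ is the set of $\nu\in\mathcal{U}$ such that, $\mathbb{P}$-a.s., $G(Q^\nu_s,D^\nu_s)\ge 0$ for all $s\in[0,T]$. $\mathcal{A}$ is the set of $\mathbb{F}$-predictable processes $(q,\phi)$ with values in $\mathbb{R}^N\times\mathbb{R}^M$. For $\nu\in\mathcal{U}_G$, problem $(P_\nu)$ is: minimize $\mathbb{E}\big[\int_0^T\sum_{i=1}^N c^i(q^i_s,Q^{i,\nu}_s)\,\mathrm{d}s\big]$ over $(q,\phi)\in\mathcal{A}$ subject to, $\mathbb{P}$-a.s. for all $s\in[0,T]$: $q^i_s+\sum_{e\in K_i}sgn(e,i)\phi^e_s\ge D^{i,\nu}_s+\sum_{e\in K_i}\frac{r^e}{2}(\phi^e_s)^2$ for $i=1,\dots,N$, $q_s\in[0,Q^\nu_s]$ and $\phi_s\in[\underline\phi,\overline\phi]$. A feasible pair is an element of $\mathcal{A}$ satisfying these constraints. $\lambda$ is the normalized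 Lebesgue measure on $[0,T]$ and $\lambda\otimes\mathbb{P}$ the product measure.
   Formalization: The ''only if'' direction (an optimal feasible pair equals (q*,φ* )(Q,D) almost everywhere) is stated under the added assumption that V_ν is finite; if V_ν = +∞ every feasible pair is optimal and that direction fails in general. *)

(* Defs.v *)
From HB Require Import structures.
From mathcomp Require Import all_boot all_order all_algebra.
From mathcomp Require Import all_classical all_reals all_analysis.

Set Implicit Arguments.
Unset Strict Implicit.
Unset Printing Implicit Defensive.

Import Order.TTheory GRing.Theory Num.Theory.
Import numFieldNormedType.Exports.

Local Open Scope classical_set_scope.
Local Open Scope ring_scope.

(* Vectors of R^n are n.-tuple R, whose canonical sigma-algebra (generated by
   the coordinates) is the Borel one. *)

(* Edge [e] is directed from [edge_tail e] to [edge_head e], and a positive flow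
   goes in that direction. Parallel edges are allowed. *)
Record network (R : realType) (N M : nat) := Network {
  edge_tail : 'I_M -> 'I_N ;
  edge_head : 'I_M -> 'I_N ;
  edge_tail_neq_head : forall e, edge_tail e != edge_head e ;
  resistance : 'I_M -> R ;
  resistance_ge0 : forall e, 0 <= resistance e ;
  flow_lo : 'I_M -> R ;
  flow_hi : 'I_M -> R ;
  flow_lo_le0 : forall e, flow_lo e <= 0 ;
  flow_hi_ge0 : forall e, 0 <= flow_hi e }.

Section DayAhead.
Context {R : realType} {N M : nat}.
Variables (net : network R N M) (c : 'I_N -> R -> R -> R).

Implicit Types (p : N.-tuple R * N.-tuple R) (x : N.-tuple R * M.-tuple R).

Definition nonneg_vec (n : nat) (v : n.-tuple R) : Prop :=
  forall i, 0 <= tnth v i.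

Definition incident (i : 'I_N) : {set 'I_M} :=
  [set e | (edge_tail net e == i) || (edge_head net e == i)]%SET.

(* Only meaningful for [e \in incident i]. *)
Definition sgn (e : 'I_M) (i : 'I_N) : R := if edge_head net e == i then 1 else -1.

Definition in_box (Q : N.-tuple R) x : Prop :=
  (forall i, 0 <= tnth x.1 i <= tnth Q i) /\
  (forall e, flow_lo net e <= tnth x.2 e <= flow_hi net e).

(* In the definitions below p = (Q, D) and x = (q, phi). *)
Definition dap_feasible p x : Prop :=
  (forall i, tnth p.2 i +
               \sum_(e in incident i) resistance net e / 2 * tnth x.2 e ^+ 2
             <= tnth x.1 i + \sum_(e in incident i) sgn e i * tnth x.2 e) /\
  in_box p.1 x.

Definition dap_cost (Q q : N.-tuple R) : R :=
  \sum_(i < N) c i (tnth q i) (tnth Q i).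

Definition dap_solution p x : Prop :=
  dap_feasible p x /\
  forall y, dap_feasible p y -> dap_cost p.1 x.1 <= dap_cost p.1 y.1.

(* Extended reals provide the neutral element +oo of min; for N >= 1 and Q >= 0
   the box is compact and nonempty, so the supremum is a (finite) maximum. *)
Definition Gmargin p : \bar R :=
  ereal_sup [set \big[Order.min/+oo%E]_(i < N)
      (tnth x.1 i - tnth p.2 i +
       \sum_(e in incident i)
          (sgn e i * tnth x.2 e - resistance net e / 2 * tnth x.2 e ^+ 2))%:E
    | x in [set x | in_box p.1 x]].

Definition Kset : set (N.-tuple R * N.-tuple R) :=
  [set p | [/\ nonneg_vec p.1, nonneg_vec p.2 & (0 <= Gmargin p)%E]].

(* (q_star, phi_star): the solution of (DAP) on Kset, [ext] outside Kset.
   The default value of [xget] is irrelevant, as a solution exists on Kset. *)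
Definition dap_star (ext : N.-tuple R * N.-tuple R -> N.-tuple R * M.-tuple R)
    p : N.-tuple R * M.-tuple R :=
  if `[< Kset p >] then xget (ext p) [set x | dap_solution p x] else ext p.

(* c i is a function on R_+ x R_+; its values elsewhere are unconstrained. *)
Definition cost_assumption : Prop := forall i,
  (forall q Q : R, 0 <= q -> 0 <= Q -> 0 <= c i q Q) /\
  (forall q : R, 0 <= q -> measurable_fun (`[0, +oo[%classic : set R) (c i q)) /\
  (forall Q : R, 0 <= Q ->
    [/\ {within `[0, +oo[, continuous (fun q : R => c i q Q)},
        convex_function (`[0, +oo[%classic : set R) (fun q : R => c i q Q),
        {in `[0, +oo[ &, {homo (fun q : R => c i q Q) : x y / x < y}},
        c i 0 Q = 0 &
        exists2 l : R, 0 < l & (c i q Q / q) @[q --> 0^'+] --> l]).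

End DayAhead.

Section Predictable.
Context {R : realType} {d : measure_display} {Omega : measurableType d}.
Variables (T : R) (F : R -> set (set Omega)).

Definition filtration : Prop :=
  (forall t, 0 <= t <= T ->
     sigma_algebra [set: Omega] (F t) /\ F t `<=` measurable) /\
  (forall s t, 0 <= s -> s <= t -> t <= T -> F s `<=` F t).

Definition predictable_rectangles : set (set (R * Omega)) :=
  [set B | exists2 A, F 0 A & B = [set 0] `*` A] `|`
  [set B | exists s t A,
     [/\ 0 <= s, s < t, t <= T, F s A & B = `]s, t] `*` A]].

(* The predictable sigma-algebra on [0, T] x Omega. *)
Definition predictable_sets : set (set (R * Omega)) :=
  <<s `[0, T] `*` [set: Omega], predictable_rectangles >>.

(* Processes are indexed by R but only their restriction to [0, T] matters. *)
Definition predictable (dV : measure_display) (V : measurableType dV)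
    (X : R -> Omega -> V) : Prop :=
  forall B, measurable B ->
    predictable_sets
      [set z | 0 <= z.1 <= T /\ B (X z.1 z.2)].

Definition control (k : nat) (U : set (k.-tuple R))
    (nu : R -> Omega -> k.-tuple R) : Prop :=
  predictable nu /\ forall s w, 0 <= s <= T -> U (nu s w).

End Predictable.

Definition compact_vec (R : realType) (k : nat) (U : set (k.-tuple R)) : Prop :=
  compact [set (\row_(i < k) tnth u i : 'rV[R]_k) | u in U].

Section StochasticProblem.
Context {R : realType} {d : measure_display} {Omega : measurableType d}.
Context {N M : nat}.
Variables (P : probability Omega R) (T : R) (F : R -> set (set Omega)).
Variables (net : network R N M) (c : 'I_N -> R -> R -> R).
(* Capacity and demand processes. *)
Variables (Q D : R -> Omega -> N.-tuple R).

Definition always_feasible : Prop :=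
  {ae P, forall w, forall s, 0 <= s <= T -> (0 <= Gmargin net (Q s w, D s w))%E}.

Definition pnu_feasible (x : R -> Omega -> N.-tuple R * M.-tuple R) : Prop :=
  predictable T F x /\
  {ae P, forall w, forall s, 0 <= s <= T ->
    dap_feasible net (Q s w, D s w) (x s w)}.

Definition pnu_cost (x : R -> Omega -> N.-tuple R * M.-tuple R) : \bar R :=
  (\int[P]_w \int[lebesgue_measure]_(s in `[0%R, T])
     (dap_cost c (Q s w) (x s w).1)%:E)%E.

Definition pnu_optimal (x : R -> Omega -> N.-tuple R * M.-tuple R) : Prop :=
  pnu_feasible x /\ forall y, pnu_feasible y -> (pnu_cost x <= pnu_cost y)%E.

Definition pnu_value : \bar R :=
  ereal_inf [set pnu_cost x | x in [set x | pnu_feasible x]].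

End StochasticProblem.

(* Main.v *)
(* Pointwise in (s, w), (P_nu) is the day-ahead problem, so the process of its
   solutions is optimal once it is known to be predictable, and, when the value
   is finite, an optimal process must solve it almost everywhere.

   Uniqueness, although the costs are not strictly convex: among the solutions
   of (DAP), take one whose set Z of nodes with a slack balance constraint is
   largest. Nodes of Z produce nothing, and no line carries power into Z, since
   reducing this flow would make the sending node slack too. Hence the net
   inflow into Z is nonpositive, while at each node of Z it exceeds the demand:
   Z is empty. So every solution is tight, whereas the losses make the midpoint
   of two solutions with distinct flows slack.

   Measurability: dispatches are parametrized by the compact cube [0, 1]^(N + M)
   independently of (Q, D). If h(p, u) is continuous in u and measurable in p,
   then {p | exists u in the cube, h(p, u) <= 0} is measurable, because by
   compactness it suffices to look for h(p, u) < 1 / (j + 1) on a countable grid.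
   With penalty functions h this gives the measurability of K, of the value of
   (DAP), and, by uniqueness, of each coordinate of its solution. *)
Require Import Defs.
From HB Require Import structures.
From mathcomp Require Import all_boot all_order all_algebra.
From mathcomp Require Import all_classical all_reals all_analysis.
From mathcomp Require Import measurable_realfun.
From mathcomp Require Import ring lra.

Set Implicit Arguments.
Unset Strict Implicit.
Unset Printing Implicit Defensive.

Import Order.TTheory GRing.Theory Num.Theory.
Import numFieldNormedType.Exports.

Local Open Scope classical_set_scope.
Local Open Scope ring_scope.

(** * Uniqueness for the day-ahead problem *)

Section DayAheadUniqueness.
Context {R : realType} {N M : nat}.
Variables (net : network R N M) (c : 'I_N -> R -> R -> R).
Hypothesis hc : cost_assumption c.
Hypothesis hr : forall e, 0 < resistance net e.

(** Half of the loss [resistance * f ^+ 2] is charged to each end of an edge, so the inflows at its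
    two ends add up to minus the whole loss. *)
Definition edge_inflow (e : 'I_M) (i : 'I_N) (f : R) : R :=
  sgn net e i * f - resistance net e / 2 * f ^+ 2.

Definition net_inflow (phi : M.-tuple R) (i : 'I_N) : R :=
  \sum_(e in incident net i) edge_inflow e i (tnth phi e).

Definition slack (p : N.-tuple R * N.-tuple R) (x : N.-tuple R * M.-tuple R) :=
  [set i | tnth p.2 i < tnth x.1 i + net_inflow x.2 i]%SET.

Lemma dap_feasibleE p x : dap_feasible net p x <->
  (forall i, tnth p.2 i <= tnth x.1 i + net_inflow x.2 i) /\ in_box net p.1 x.
Proof.
split=> -[H B]; split=> // i; have := H i; rewrite /net_inflow sumrB; lra.
Qed.

Lemma tail_incident e : e \in incident net (edge_tail net e).
Proof. by rewrite inE eqxx. Qed.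

Lemma sgn_tail e : sgn net e (edge_tail net e) = -1.
Proof. by rewrite /sgn eq_sym (negbTE (edge_tail_neq_head net e)). Qed.

Lemma sgn_head e : sgn net e (edge_head net e) = 1.
Proof. by rewrite /sgn eqxx. Qed.

(** Exchanging the sums leaves the two ends of each edge, so the sign of a total over [Z] can be
    read off edge by edge. *)
Lemma sum_net_inflow (Z : {set 'I_N}) phi :
  \sum_(i in Z) net_inflow phi i =
  \sum_e
    ((edge_tail net e \in Z)%:R * edge_inflow e (edge_tail net e) (tnth phi e)
   + (edge_head net e \in Z)%:R * edge_inflow e (edge_head net e) (tnth phi e)).
Proof.
rewrite /net_inflow.
under eq_bigr do rewrite big_mkcond/=.
rewrite exchange_big/=; apply: eq_bigr => e _.
rewrite big_mkcond/= (bigD1 (edge_tail net e))//=.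
rewrite (bigD1 (edge_head net e))/=; last by rewrite eq_sym edge_tail_neq_head.
rewrite big1 ?addr0; last first.
  move=> i /andP[/negbTE it /negbTE ih].
  by rewrite !inE ![_ == i]eq_sym it ih/= if_same.
rewrite !inE !eqxx orbT/=.
by congr (_ + _); case: ifP => _; rewrite ?mul1r ?mul0r.
Qed.

Lemma incident_neq e i j : i != j ->
    e \in incident net i -> e \in incident net j ->
  (edge_tail net e = i /\ edge_head net e = j) \/
  (edge_tail net e = j /\ edge_head net e = i).
Proof.
rewrite !inE => ij /orP[] /eqP ei /orP[] /eqP ej; try by [left|right].
- by move: ij; rewrite -ei ej eqxx.
- by move: ij; rewrite -ei ej eqxx.
Qed.

(** Otherwise production at [i] could be lowered without violating its balance, and the cost is
    strictly increasing. *)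
Lemma solution_slack_q0 p x i : nonneg_vec p.1 -> dap_solution net c p x ->
  i \in slack p x -> tnth x.1 i = 0.
Proof.
move=> Q0 [/dap_feasibleE [xf [xq xphi]] xmin]; rewrite inE => si.
apply/eqP/contraT => qi0.
have qi : 0 < tnth x.1 i by rewrite lt_neqAle eq_sym qi0; case/andP: (xq i).
(* The least nonnegative production that still covers the demand at [i]. *)
pose q' := Num.max 0 (tnth p.2 i - net_inflow x.2 i).
have q'lt : q' < tnth x.1 i by rewrite /q' gt_max qi/=; move: si; lra.
have q'0 : 0 <= q' by rewrite /q' le_max lexx.
have q'D : tnth p.2 i - net_inflow x.2 i <= q' by rewrite /q' le_max lexx orbT.
pose y := ([tuple (if j == i then q' else tnth x.1 j) | j < N], x.2).
have yq j : tnth y.1 j = if j == i then q' else tnth x.1 j by rewrite tnth_mktuple.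
have yf : dap_feasible net p y.
  apply/dap_feasibleE; split=> [j|].
    rewrite yq; case: eqP => [->|_]; last exact: xf.
    by move: q'D; rewrite /y/=; lra.
  split=> // j; rewrite yq; case: eqP => [->|_]; last exact: xq.
  by rewrite q'0/=; have /andP[_] := xq i; apply: le_trans; exact: ltW.
have := xmin _ yf.
rewrite leNgt /dap_cost (bigD1 i)//= [X in _ < X](bigD1 i)//= yq eqxx.
rewrite (eq_bigr (fun j => c j (tnth x.1 j) (tnth p.1 j))); last first.
  by move=> j /negbTE ji; rewrite yq ji.
rewrite ltrD2r.
have [_ [_ /(_ _ (Q0 i))[_ _ + _ _]]] := hc i.
by move=> -> //; rewrite in_itv/= ?q'0// ltW.
Qed.

(* Lowering the flow that the slack node [i] receives along [e] makes the other
   end [j] slack, at no cost. *)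
Lemma solution_shift_flow p x e i j :
  i \in slack p x -> j \notin slack p x -> i != j ->
  e \in incident net i -> e \in incident net j ->
  0 < sgn net e i * tnth x.2 e -> dap_solution net c p x ->
  exists2 y, dap_solution net c p y & (j |: slack p x)%SET \subset slack p y.
Proof.
move=> si sj ij ei ej; set f := tnth x.2 e; set a := _ * f => a0.
move=> [/dap_feasibleE [xf [xq xphi]] xmin].
have sgnij : sgn net e j = - sgn net e i.
  case: (incident_neq ij ei ej) => -[ti hj].
    by rewrite -{1}hj -ti sgn_head sgn_tail opprK.
  by rewrite -ti -{1}hj sgn_head sgn_tail.
(* From here on, [a] is the flow counted positively towards [i]. *)
have ff : f = sgn net e i * a.
  by rewrite /a mulrA /sgn; case: ifP; rewrite ?mulrNN ?mul1r.
clearbody a.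
have sgn2 : sgn net e i ^+ 2 = 1 by rewrite /sgn; case: ifP; rewrite ?sqrrN expr1n.
move: (si); rewrite inE => si'.
pose s := tnth x.1 i + net_inflow x.2 i - tnth p.2 i.
have s0 : 0 < s by rewrite /s; lra.
(* The flow towards [i] drops from [a] to [b] by at most [s / 2] and keeps its direction, so [i]
   keeps at least half of its slack. The losses decrease too, which helps both ends. *)
pose b : R := Num.max 0 (a - s / 2).
have b0 : 0 <= b by rewrite le_max lexx.
have ba : b < a by rewrite gt_max a0; lra.
have bs : a - s / 2 <= b by rewrite le_max lexx orbT.
pose y := (x.1, [tuple (if k == e then sgn net e i * b else tnth x.2 k) | k < M]).
have yphi k : tnth y.2 k = if k == e then sgn net e i * b else tnth x.2 k.
  by rewrite tnth_mktuple.
have re := hr e.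
have infE k : net_inflow y.2 k = net_inflow x.2 k +
    (e \in incident net k)%:R *
       (edge_inflow e k (sgn net e i * b) - edge_inflow e k f).
  rewrite /net_inflow; case: (boolP (e \in _)) => ek; last first.
    rewrite mul0r addr0; apply: eq_bigr => e' e'k; rewrite yphi.
    by case: eqP => // ee'; move: ek; rewrite -ee' e'k.
  rewrite mul1r (bigD1 e)//= [in RHS](bigD1 e)//= yphi eqxx -/f.
  rewrite (eq_bigr (fun e' => edge_inflow e' k (tnth x.2 e'))); first ring.
  by move=> e' /andP[_ /negbTE e'e]; rewrite yphi e'e.
have sM z : sgn net e i * (sgn net e i * z) = z by rewrite mulrA -expr2 sgn2 mul1r.
have infj : net_inflow x.2 j < net_inflow y.2 j.
  rewrite infE ej mul1r ltrDl subr_gt0 /edge_inflow ff sgnij !mulNr !sM.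
  rewrite !exprMn sgn2 !mul1r.
  have : b ^+ 2 <= a ^+ 2 by rewrite ler_sqr ?nnegrE//; lra.
  by move/(ler_wpM2l (ltW re)); lra.
have infi : net_inflow x.2 i - s / 2 <= net_inflow y.2 i.
  rewrite infE ei mul1r /edge_inflow ff.
  rewrite !sM !exprMn sgn2 !mul1r.
  have : b ^+ 2 <= a ^+ 2 by rewrite ler_sqr ?nnegrE//; lra.
  by move/(ler_wpM2l (ltW re)); lra.
have infk k : k != i -> k != j -> net_inflow y.2 k = net_inflow x.2 k.
  move=> ki kj; rewrite infE; suff -> : (e \in incident net k) = false.
    by rewrite mul0r addr0.
  rewrite inE ![_ == k]eq_sym.
  by case: (incident_neq ij ei ej) => -[-> ->]; rewrite (negbTE ki) (negbTE kj).
have yf k : tnth p.2 k <= tnth y.1 k + net_inflow y.2 k.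
  have [->|ki] := eqVneq k i; first by move: infi; rewrite /s /y/=; lra.
  have [->|kj] := eqVneq k j; first by have := xf j; move: infj; rewrite /y/=; lra.
  by rewrite infk.
have yfeas : dap_feasible net p y.
  apply/dap_feasibleE; split=> //; split=> // k; rewrite yphi.
  case: eqP => [->|_]; last exact: xphi.
  (* The new flow lies between 0 and the old one, and both are within the limits. *)
  have := xphi e; rewrite -/f ff.
  have := flow_lo_le0 net e; have := flow_hi_ge0 net e; move: ba b0.
  by rewrite /sgn; case: ifP => _; rewrite ?mulN1r ?mul1r; lra.
exists y; first by split=> // z /xmin.
apply/fintype.subsetP => k; rewrite 3!inE => /orP[/eqP ->|].
  by rewrite inE; have := xf j; move: infj; rewrite /y/=; lra.
rewrite !inE.
have [->|ki] := eqVneq k i; first by move: infi; rewrite /s /y/=; lra.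
have [->|kj] := eqVneq k j; first by have := xf j; move: infj; rewrite /y/=; lra.
by rewrite infk.
Qed.

Lemma solution_tight p x : nonneg_vec p.1 -> nonneg_vec p.2 ->
  dap_solution net c p x ->
  forall i, tnth p.2 i = tnth x.1 i + net_inflow x.2 i.
Proof.
move=> Q0 D0 xs i; apply/eqP; rewrite eq_le; apply/andP; split.
  by case: xs => /dap_feasibleE [].
rewrite leNgt; apply/negP => xi.
pose card_slack n := `[< exists2 y, dap_solution net c p y & #|slack p y| = n >].
have ex : exists n, card_slack n by exists #|slack p x|; apply/asboolP; exists x.
have bd n : card_slack n -> (n <= N)%N.
  by move=> /asboolP[y _ <-]; rewrite -[leqRHS]card_ord max_card.
(* [y] is a solution with the most slack nodes, hence with at least one, since [x] has one. *)
case: (ex_maxnP ex bd) => n /asboolP[y ys <-] ymax {n}.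
have sx : i \in slack p x by rewrite inE.
have sy : (0 < #|slack p y|)%N.
  rewrite (@leq_trans #|slack p x|)//; first by apply/card_gt0P; exists i.
  by apply: ymax; apply/asboolP; exists x.
(* No edge brings positive flow into the slack set of [y] from outside: shifting it would add the
   sender to the set, against maximality. *)
have out e i' j' : i' \in slack p y -> j' \notin slack p y -> i' != j' ->
    e \in incident net i' -> e \in incident net j' ->
    sgn net e i' * tnth y.2 e <= 0.
  move=> si sj ij ei ej; rewrite leNgt; apply/negP => pos.
  have [z zs sub] := solution_shift_flow si sj ij ei ej pos ys.
  have : (#|slack p z| <= #|slack p y|)%N by apply: ymax; apply/asboolP; exists z.
  rewrite leqNgt => /negP; apply.
  by rewrite (leq_trans _ (subset_leq_card sub))// cardsU1 sj.
have : \sum_(i in slack p y) net_inflow y.2 i <= 0.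
  rewrite sum_net_inflow; apply: sumr_le0 => e _.
  have th := edge_tail_neq_head net e.
  have re := mulr_ge0 (ltW (hr e)) (sqr_ge0 (tnth y.2 e)).
  have ei := tail_incident e.
  have ej : e \in incident net (edge_head net e) by rewrite inE eqxx orbT.
  have := out e (edge_tail net e) (edge_head net e).
  have := out e (edge_head net e) (edge_tail net e).
  rewrite eq_sym th ei ej /edge_inflow sgn_tail sgn_head.
  (* With both ends in the set, an edge contributes minus its loss; with one end, a flow that [out]
     makes nonpositive, minus half the loss. *)
  case: (_ \in _); case: (_ \in _); rewrite /= ?mul1r ?mul0r.
  - by move=> _ _; lra.
  - by move=> /(_ isT isT isT isT isT) + _; lra.
  - by move=> _ /(_ isT isT isT isT isT); lra.
  - by move=> _ _; lra.
(* A slack node produces nothing, so its inflow alone exceeds its nonnegative demand. *)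
have inflow_gt0 j : j \in slack p y -> 0 < net_inflow y.2 j.
  move=> sj; have := solution_slack_q0 Q0 ys sj; move: sj; rewrite inE => + q0.
  by rewrite q0 add0r; apply: le_lt_trans.
apply/negP; rewrite -ltNge; case/card_gt0P: sy => j sj.
rewrite (bigD1 j)//=; apply: ltr_wpDr (inflow_gt0 _ sj).
by apply: sumr_ge0 => l /andP[/inflow_gt0 /ltW].
Qed.

(** The loss is quadratic, and the square of a mean is the mean of the squares minus
    [(a - b) ^+ 2 / 4]. The last sum is what averaging the flows saves at node [i]. *)
Lemma net_inflow_midpoint phi psi i :
  net_inflow [tuple (tnth phi e + tnth psi e) / 2 | e < M] i =
  (net_inflow phi i + net_inflow psi i) / 2 +
  \sum_(e in incident net i)
     resistance net e / 8 * (tnth phi e - tnth psi e) ^+ 2.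
Proof.
rewrite /net_inflow -big_split/= mulr_suml -big_split/=; apply: eq_bigr => e _.
by rewrite tnth_mktuple /edge_inflow; field.
Qed.

Lemma cost_midpoint i (q q' z : R) : 0 <= q -> 0 <= q' -> 0 <= z ->
  c i ((q + q') / 2) z <= (c i q z + c i q' z) / 2.
Proof.
move=> q0 q'0 z0; have [_ [_ /(_ _ z0)[_ + _ _ _]]] := hc i.
have h0 : 0 <= (2^-1 : R) by [].
have h1 : (2^-1 : R) <= 1 by rewrite invf_le1// ler1n.
pose t := Itv01 h0 h1.
move=> /(_ t q q'); rewrite !inE/= !in_itv/= !andbT => /(_ q0 q'0).
rewrite !convRE /= /unstable.onem.
have <- : 2^-1 * q + (1 - 2^-1) * q' = (q + q') / 2 by field.
by move=> /le_trans; apply; rewrite le_eqVlt; apply/orP; left; apply/eqP; field.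
Qed.

(** By convexity the midpoint of two solutions is a solution. All three are tight, so the gain in
    [net_inflow_midpoint] vanishes and the flows agree; the tight balances then determine the
    productions. *)
Lemma dap_solution_unique p x y : nonneg_vec p.1 -> nonneg_vec p.2 ->
  dap_solution net c p x -> dap_solution net c p y -> x = y.
Proof.
move=> Q0 D0 xs ys.
have [/dap_feasibleE [xf [xq xphi]] xmin] := xs.
have [/dap_feasibleE [yf [yq yphi]] ymin] := ys.
pose z := ([tuple (tnth x.1 i + tnth y.1 i) / 2 | i < N],
           [tuple (tnth x.2 e + tnth y.2 e) / 2 | e < M]).
have sq_ge0 i : 0 <= \sum_(e in incident net i)
    resistance net e / 8 * (tnth x.2 e - tnth y.2 e) ^+ 2.
  apply: sumr_ge0 => e _; apply: mulr_ge0 (sqr_ge0 _).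
  by apply: divr_ge0; rewrite // ltW.
have zf : dap_feasible net p z.
  apply/dap_feasibleE; split=> [i|]; last split=> i /=; rewrite tnth_mktuple.
  - rewrite net_inflow_midpoint; have := xf i; have := yf i; have := sq_ge0 i.
    by lra.
  - by have := xq i; have := yq i; lra.
  - by have := xphi i; have := yphi i; lra.
have zs : dap_solution net c p z.
  split=> // w /[dup] /xmin xw /ymin yw.
  apply: (@le_trans _ _ ((dap_cost c p.1 x.1 + dap_cost c p.1 y.1) / 2)).
    rewrite /dap_cost -big_split/= mulr_suml; apply: ler_sum => i _.
    rewrite tnth_mktuple; apply: cost_midpoint (Q0 i).
    - by case/andP: (xq i).
    - by case/andP: (yq i).
  by move: xw yw; lra.
have xyphi : x.2 = y.2.
  apply: eq_from_tnth => e; set i := edge_tail net e.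
  have /eqP : \sum_(e in incident net i)
      resistance net e / 8 * (tnth x.2 e - tnth y.2 e) ^+ 2 = 0.
    have := solution_tight Q0 D0 zs i.
    rewrite tnth_mktuple net_inflow_midpoint.
    by rewrite (solution_tight Q0 D0 xs i); have := solution_tight Q0 D0 ys i;
       rewrite (solution_tight Q0 D0 xs i); lra.
  rewrite psumr_eq0 => [/allP /(_ e (mem_index_enum e))|e' _]; last first.
    by apply: mulr_ge0 (sqr_ge0 _); apply: divr_ge0; rewrite // ltW.
  rewrite tail_incident/= mulf_eq0 sqrf_eq0 subr_eq0 => /orP[|/eqP//].
  by rewrite mulf_eq0 gt_eqF//= invr_eq0 pnatr_eq0.
have xyq : x.1 = y.1.
  apply: eq_from_tnth => i.
  have := solution_tight Q0 D0 xs i; rewrite (solution_tight Q0 D0 ys i) xyphi.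
  by move/addIr.
by case: x y xyphi xyq {xs ys xf xq xphi xmin yf yq yphi ymin z zf zs sq_ge0}
  => [? ?] [? ?] /= -> ->.
Qed.

End DayAheadUniqueness.

(** * Penalty functions on the unit cube *)

Definition unit_cube (R : realType) n : set 'rV[R]_n :=
  [set u | forall i, `[0, 1]%classic (u ord0 i)].
Arguments unit_cube : clear implicits.

Lemma compact_unit_cube (R : realType) n : compact (unit_cube R n).
Proof. apply: (@rV_compact R n (fun=> `[0, 1]%classic)) => i.
exact: segment_compact. Qed.

Lemma unit_cube0 (R : realType) n : unit_cube R n 0.
Proof. by move=> i; rewrite mxE /= in_itv /= lexx ler01. Qed.

(** The minimum over the compact cube is attained and cannot be positive. This turns approximate
    zeros of a penalty into exact ones. *)
Lemma unit_cube_le0 (R : realType) n (h : 'rV[R]_n -> R) : continuous h ->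
  (forall e, 0 < e -> exists2 u, unit_cube R n u & h u < e) ->
  exists2 u, unit_cube R n u & h u <= 0.
Proof.
move=> ch he.
have cube0 : unit_cube R n !=set0 by exists 0; exact: unit_cube0.
have [u] := compact_EVT_min cube0 (@compact_unit_cube R n) (continuous_subspaceT ch).
rewrite inE => uc umin; exists u => //.
rewrite leNgt; apply/negP => /he[w wc].
by rewrite ltNge umin// inE.
Qed.

Definition grid_point (R : realType) n (m : nat) (k : {ffun 'I_n -> 'I_m.+1}) :
  'rV[R]_n := \row_i ((k i)%:R / m%:R).

Lemma grid_point_cube (R : realType) n m (k : {ffun 'I_n -> 'I_m.+1}) :
  unit_cube R n (grid_point R k).
Proof.
move=> i; rewrite mxE/= in_itv/= divr_ge0//=.
(* For [m = 0] the quotient is 0, the value of a division by zero. *)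
case: m k => [|m] k; first by rewrite invr0 mulr0.
by rewrite ler_pdivrMr ?ltr0n// mul1r ler_nat -ltnS.
Qed.

Lemma grid_point_dense (R : realType) n (u : 'rV[R]_n) (A : set 'rV[R]_n) :
  unit_cube R n u -> nbhs u A ->
  exists m (k : {ffun 'I_n -> 'I_m.+1}), A (grid_point R k).
Proof.
move=> uc /nbhs_ballP[e /= e0 eA].
have [m me] : exists m, e^-1 < m.+1%:R.
  exists (Num.truncn e^-1); exact: truncnS_gt.
(* Coordinates are rounded down to multiples of [1 / m.+1]; a coordinate equal to 1 has index
   [m.+1], whence the bound [m.+2]. *)
have tr i : (Num.truncn (u ord0 i * m.+1%:R) < m.+2)%N.
  rewrite ltnS; have := uc i; rewrite /= in_itv/= => /andP[u0 u1].
  rewrite truncn_le_nat (@le_lt_trans _ _ m.+1%:R) ?ltr_nat//.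
  by rewrite ler_piMl.
exists m.+1, [ffun i => Ordinal (tr i)]; apply: eA; split=> // i j.
rewrite ord1 mxE ffunE/= /ball/=.
have := uc j; rewrite /= in_itv/= => /andP[u0 u1].
have /truncn_itv /andP[lo hi] : 0 <= u ord0 j * m.+1%:R by rewrite mulr_ge0.
have m0 : 0 < m.+1%:R :> R by rewrite ltr0n.
rewrite ger0_norm; last by rewrite subr_ge0 ler_pdivrMr.
rewrite -(ltr_pM2r m0) mulrBl divfK ?gt_eqF//.
have : 1 < e * m.+1%:R by rewrite mulrC -ltr_pdivrMr// div1r.
by move: lo hi; rewrite -natr1; lra.
Qed.

Lemma measurable_exists_le0 d (T : measurableType d) (R : realType) n
    (h : T -> 'rV[R]_n -> R) :
  (forall p, continuous (h p)) -> (forall u, measurable_fun setT (h^~ u)) ->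
  measurable [set p | exists2 u, unit_cube R n u & h p u <= 0].
Proof.
move=> ch mh.
rewrite [X in measurable X](_ : _ = \bigcap_j \bigcup_m
  \bigcup_(k in [set: {ffun 'I_n -> 'I_m.+1}])
    [set p | h p (grid_point R k) < j.+1%:R^-1]).
  apply: bigcapT_measurable => j; apply: bigcupT_measurable => m.
  apply: fin_bigcup_measurable => // k _.
  rewrite [X in measurable X](_ : _ = setT `&`
    h^~ (grid_point R k) @^-1` `]-oo, j.+1%:R^-1[%classic); first exact: mh.
  by rewrite setTI; apply/seteqP; split=> p /=; rewrite in_itv.
apply/seteqP; split=> p /=.
  (* By continuity [h p] stays below [1 / j.+1] near [u], hence at some grid point. *)
  move=> [u uc hu] j _.
  have hlt : h p u < j.+1%:R^-1 by rewrite (le_lt_trans hu)// invr_gt0.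
  have [m [k hk]] := grid_point_dense uc
    (@cvgr_lt _ _ _ (nbhs_filter u) _ _ (ch p u) _ hlt).
  by exists m => //; exists k.
move=> H; apply: unit_cube_le0 (ch p) _ => e e0.
have [j je] : exists j, e^-1 < j.+1%:R.
  by exists (Num.truncn e^-1); exact: truncnS_gt.
have [m _ [k _ /= hk]] := H j I.
exists (grid_point R k); first exact: grid_point_cube.
apply: lt_trans hk _; rewrite invf_plt ?posrE//.
Qed.

(** * Measurability from sublevel sets and of Caratheodory functions *)

Lemma measurable_fun_le_set d (T : measurableType d) (R : realType) (f : T -> R) :
  (forall a, measurable [set t | f t <= a]) -> measurable_fun setT f.
Proof.
move=> mf mT; apply: (measurability _ (RGenOInfty.measurableE R)) => //.
move=> _ [_ [a ->] <-]; rewrite setTI.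
rewrite [X in measurable X](_ : _ = ~` [set t | f t <= a]).
  exact: measurableC.
by apply/seteqP; split=> t /=; rewrite in_itv/= andbT ltNge => /negP.
Qed.

(** Rounding [f] down to multiples of [1 / n.+1] leaves countably many first arguments, for each of
    which [h] is measurable in the second; continuity in the first argument allows the passage to
    the limit. *)
Lemma measurable_caratheodory d (T : measurableType d) (R : realType)
    (h : R -> R -> R) (f g : T -> R) :
  (forall y, continuous (h^~ y)) -> (forall x, measurable_fun setT (h x)) ->
  measurable_fun setT f -> measurable_fun setT g ->
  measurable_fun setT (fun t => h (f t) (g t)).
Proof.
move=> ch mh mf mg.
pose a n (z : int) : R := z%:~R / n.+1%:R.
pose fl n t := Num.floor (f t * n.+1%:R).
apply: (@measurable_fun_cvg _ _ _ _
  (fun n t => h (a n (fl n t)) (g t))) => [n _ Y mY|t _].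
  rewrite setTI [X in measurable X](_ : _ = \bigcup_(z in [set: int])
    ([set t | fl n t = z] `&` [set t | Y (h (a n z) (g t))])).
    apply: countable_bigcupT_measurable => // z; apply: measurableI.
      rewrite [X in measurable X](_ : _ =
          f @^-1` `[a n z, a n (z + 1)[%classic).
        by rewrite -[X in measurable X]setTI; apply: mf.
      apply/seteqP; split=> t /=; rewrite in_itv/= /a /fl.
        by move=> <-; rewrite ler_pdivrMr// ltr_pdivlMr// floor_itv.
      rewrite ler_pdivrMr// ltr_pdivlMr// => /floor_def; apply.
    have mhg : measurable_fun setT (fun t => h (a n z) (g t)).
      exact: measurableT_comp.
    by rewrite -[X in measurable X]setTI; exact: mhg.
  apply/seteqP; split=> t /=; first by exists (fl n t).
  by move=> [z _ [<-]].
apply: (@continuous_cvg _ _ _ _ _ _ (h^~ (g t))); first exact: ch.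
apply: (@squeeze_cvgr _ _ _ _ (fun n => f t - harmonic n) (cst (f t))).
- apply: nearW => n /=; rewrite /a /harmonic/=.
  have /andP[lo hi] := floor_itv (f t * n.+1%:R).
  rewrite ler_pdivrMr// lo andbT ler_pdivlMr// mulrBl mulVf// lerBlDr.
  by rewrite ltW// -intrD1.
- by rewrite -[X in _ --> X]subr0; apply: cvgB; [exact: cvg_cst|exact: cvg_harmonic].
- exact: cvg_cst.
Qed.

(** * Continuity of real-valued expressions *)

Lemma continuous_max0 (T : topologicalType) (R : realType) (f : T -> R) :
  continuous f -> continuous (fun x => Num.max 0 (f x)).
Proof.
move=> cf x.
apply: (@continuous2_cvg T R R R (nbhs x) _ (fun=> 0) f Num.max 0 (f x)).
- exact: (@max_continuous _ R (0 : R, f x)).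
- exact: cvg_cst.
- exact: cf.
Qed.

Lemma continuous_sum (T : topologicalType) (R : realType) (I : finType)
    (P : pred I) (f : I -> T -> R) :
  (forall i, continuous (f i)) -> continuous (fun x => \sum_(i | P i) f i x).
Proof.
move=> cf; apply: continuous_big => [|i _]; last exact: cf.
exact: add_continuous.
Qed.

Lemma continuous_add (T : topologicalType) (R : realType) (f g : T -> R) :
  continuous f -> continuous g -> continuous (fun x => f x + g x).
Proof. by move=> cf cg x; apply: cvgD; [exact: cf|exact: cg]. Qed.

Lemma continuous_mul (T : topologicalType) (R : realType) (f g : T -> R) :
  continuous f -> continuous g -> continuous (fun x => f x * g x).
Proof. by move=> cf cg x; apply: cvgM; [exact: cf|exact: cg]. Qed.

Lemma continuous_sub (T : topologicalType) (R : realType) (f g : T -> R) :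
  continuous f -> continuous g -> continuous (fun x => f x - g x).
Proof. by move=> cf cg x; apply: cvgB; [exact: cf|exact: cg]. Qed.

Lemma continuous_compose (T : topologicalType) (R : realType) (g : R -> R)
    (f : T -> R) :
  continuous g -> continuous f -> continuous (fun x => g (f x)).
Proof.
move=> cg cf x; apply: (@continuous_cvg _ _ _ _ _ _ g); [exact: cg|exact: cf].
Qed.

(** * Dispatches parametrized by the cube *)

Section DispatchSelection.
Context {R : realType} {N M : nat}.
Variables (net : network R N M) (c : 'I_N -> R -> R -> R).
Hypothesis hc : cost_assumption c.
Hypothesis hr : forall e, 0 < resistance net e.

Implicit Types (p : N.-tuple R * N.-tuple R) (u : 'rV[R]_(N + M)).

(* The absolute values make [c i] continuous, resp. measurable, on all of R and
   change nothing on the nonnegative arguments it is meant for. *)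
Definition abs_cost i (q z : R) : R := c i `|q| `|z|.

Lemma continuous_abs_cost i z : continuous (abs_cost i ^~ z).
Proof.
have [_ [_ /(_ _ (normr_ge0 z))[/subspace_continuousP + _ _ _ _]]] := hc i.
move=> /= cc q; have q0 : `[0, +oo[%classic `|q| by rewrite /= in_itv/= normr_ge0.
move=> A /= /(cc _ q0) /= H.
have : \forall y \near q, `|y| \in `[0, +oo[%R -> A (c i `|y| `|z|).
  exact: norm_continuous H.
by apply: filterS => y; apply; rewrite in_itv/= normr_ge0.
Qed.

Lemma measurable_abs_cost i q : measurable_fun setT (abs_cost i q).
Proof.
have [_ [/(_ _ (normr_ge0 q)) mc _]] := hc i.
have : measurable_fun setT (c i `|q| \o (fun z : R => `|z|)).
  apply: (measurable_comp _ _ mc) => //.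
  by move=> _ [z _ <-] /=; rewrite in_itv/= normr_ge0.
exact.
Qed.

Definition dispatch (Q : N.-tuple R) u : N.-tuple R * M.-tuple R :=
  ([tuple tnth Q i * u ord0 (lshift M i) | i < N],
   [tuple flow_lo net e + (flow_hi net e - flow_lo net e) * u ord0 (rshift N e)
   | e < M]).

Lemma dispatch_in_box Q u : nonneg_vec Q -> unit_cube R (N + M) u ->
  in_box net Q (dispatch Q u).
Proof.
move=> Q0 uc; split=> [i|e]; rewrite tnth_mktuple.
- have := uc (lshift M i); rewrite /= in_itv/= => /andP[u0 u1].
  by rewrite mulr_ge0//= ler_piMr.
- have := uc (rshift N e); rewrite /= in_itv/= => /andP[u0 u1].
  have lh : 0 <= flow_hi net e - flow_lo net e.
    by have := flow_lo_le0 net e; have := flow_hi_ge0 net e; lra.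
  by have := mulr_ge0 lh u0; have := ler_piMr lh u1; lra.
Qed.

(** Each coordinate inverts an affine map. Where the interval is a single point, the division by
    zero gives 0, and the box itself forces the right value. *)
Lemma in_box_dispatch Q x : nonneg_vec Q -> in_box net Q x ->
  exists2 u, unit_cube R (N + M) u & dispatch Q u = x.
Proof.
move=> Q0 [xq xphi].
exists (row_mx (\row_i (tnth x.1 i / tnth Q i))
  (\row_e ((tnth x.2 e - flow_lo net e) / (flow_hi net e - flow_lo net e)))).
  move=> j; case: (split_ordP j) => [i ->|e ->].
    rewrite row_mxEl mxE/= in_itv/=; have /andP[q0 qQ] := xq i.
    rewrite divr_ge0//=; have [->|Qi] := eqVneq (tnth Q i) 0.
      by rewrite invr0 mulr0.
    by rewrite ler_pdivrMr ?mul1r// lt0r Qi Q0.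
  rewrite row_mxEr mxE/= in_itv/=; have /andP[pl ph] := xphi e.
  have [->|lh] := eqVneq (flow_hi net e - flow_lo net e) 0.
    by rewrite invr0 mulr0 lexx ler01.
  have lh0 : 0 < flow_hi net e - flow_lo net e by rewrite lt0r lh/=; lra.
  rewrite ler_pdivrMr// mul1r lerD2r ph andbT.
  by rewrite mulr_ge0 ?invr_ge0 ?(ltW lh0)// subr_ge0.
case: x xq xphi => q phi /= xq xphi; congr pair; apply: eq_from_tnth => i.
- rewrite tnth_mktuple row_mxEl mxE; have /andP[q0 qQ] := xq i.
  have [Qi|Qi] := eqVneq (tnth Q i) 0; last by rewrite mulrC divfK.
  by rewrite Qi mul0r; apply: le_anti; rewrite q0 -Qi qQ.
- rewrite tnth_mktuple row_mxEr mxE; have /andP[pl ph] := xphi i.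
  have [lh|lh] := eqVneq (flow_hi net i - flow_lo net i) 0.
    by rewrite lh mul0r; lra.
  by rewrite [X in _ + X]mulrC divfK// addrC subrK.
Qed.

(** Only the balance constraints are penalized, as [dispatch] takes care of the box. For nonnegative
    capacities, the zeros in the cube are the feasible dispatches. *)
Definition shortfall p u : R :=
  \sum_i Num.max 0 (tnth p.2 i -
    (tnth (dispatch p.1 u).1 i + net_inflow net (dispatch p.1 u).2 i)).

Definition dispatch_cost (Q : N.-tuple R) u : R :=
  \sum_i abs_cost i (tnth (dispatch Q u).1 i) (tnth Q i).

Lemma dispatch_costE Q u : nonneg_vec Q -> unit_cube R (N + M) u ->
  dispatch_cost Q u = dap_cost c Q (dispatch Q u).1.
Proof.
move=> Q0 uc; apply: eq_bigr => i _; rewrite /abs_cost !ger0_norm//.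
by have [/(_ i)/andP[]] := dispatch_in_box Q0 uc.
Qed.

Lemma shortfall_ge0 p u : 0 <= shortfall p u.
Proof. by apply: sumr_ge0 => i _; rewrite le_max lexx. Qed.

Lemma shortfall_le0 p u : nonneg_vec p.1 -> unit_cube R (N + M) u ->
  (shortfall p u <= 0) <-> dap_feasible net p (dispatch p.1 u).
Proof.
move=> Q0 uc; rewrite dap_feasibleE; split=> [H|[H _]].
  split=> [i|]; last exact: dispatch_in_box.
  have /eqP : shortfall p u = 0.
    by apply: le_anti; rewrite H shortfall_ge0.
  rewrite psumr_eq0; last by move=> j _; rewrite le_max lexx.
  move=> /allP /(_ i (mem_index_enum i)) /eqP; rewrite -subr_le0 => <-.
  by rewrite le_max lexx orbT.
by apply: sumr_le0 => i _; rewrite ge_max lexx/= subr_le0.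
Qed.

Lemma continuous_dispatch_q Q i : continuous (fun u => tnth (dispatch Q u).1 i).
Proof.
rewrite (_ : (fun _ => _) = fun u => tnth Q i * u ord0 (lshift M i)); last first.
  by apply/funext => u; rewrite tnth_mktuple.
by apply: continuous_mul; [exact: cst_continuous|exact: coord_continuous].
Qed.

Lemma continuous_dispatch_phi Q e :
  continuous (fun u => tnth (dispatch Q u).2 e).
Proof.
rewrite (_ : (fun _ => _) = fun u => flow_lo net e +
    (flow_hi net e - flow_lo net e) * u ord0 (rshift N e)); last first.
  by apply/funext => u; rewrite tnth_mktuple.
apply: continuous_add; first exact: cst_continuous.
by apply: continuous_mul; [exact: cst_continuous|exact: coord_continuous].
Qed.

Lemma measurable_dispatch_q u i :
  measurable_fun setT (fun p => tnth (dispatch p.1 u).1 i).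
Proof.
rewrite (_ : (fun _ => _) = fun p => tnth p.1 i * u ord0 (lshift M i)); last first.
  by apply/funext => p; rewrite tnth_mktuple.
apply: measurable_funM => //.
by apply: (measurableT_comp (measurable_tnth i)).
Qed.

Lemma continuous_shortfall p : continuous (shortfall p).
Proof.
apply: continuous_sum => i; apply: continuous_max0.
apply: continuous_sub; first exact: cst_continuous.
apply: continuous_add; first exact: continuous_dispatch_q.
apply: continuous_sum => e; apply: continuous_sub; apply: continuous_mul;
  try exact: cst_continuous.
- exact: continuous_dispatch_phi.
- by apply: continuous_mul; exact: continuous_dispatch_phi.
Qed.

Lemma measurable_shortfall u : measurable_fun setT (shortfall^~ u).
Proof.
apply: measurable_sum => i; apply: measurable_maxr => //.
apply: measurable_funB.
  by apply: (measurableT_comp (measurable_tnth i)).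
apply: measurable_funD; first exact: measurable_dispatch_q.
(* At fixed [u] the flows of a dispatch are the same for all [p]. *)
by rewrite /dispatch/=; exact: measurable_cst.
Qed.

Lemma continuous_dispatch_cost Q : continuous (dispatch_cost Q).
Proof.
apply: continuous_sum => i.
apply: (@continuous_compose _ _ (abs_cost i ^~ (tnth Q i))).
  exact: continuous_abs_cost.
exact: continuous_dispatch_q.
Qed.

(** Production and capacity both vary with [p], and the costs are continuous in the former but only
    measurable in the latter. *)
Lemma measurable_dispatch_cost u :
  measurable_fun setT (fun p => dispatch_cost p.1 u).
Proof.
apply: measurable_sum => i; apply: measurable_caratheodory.
- exact: continuous_abs_cost.
- exact: measurable_abs_cost.
- exact: measurable_dispatch_q.
- by apply: (measurableT_comp (measurable_tnth i)).
Qed.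

End DispatchSelection.

(** * Existence and measurability of the day-ahead solution *)

(** For functions defined by cases: outside [K] measurability comes from [g], so only the sublevel
    sets inside [K] call for an argument. *)
Lemma measurable_patch d (T : measurableType d) (R : realType) (K : set T)
    (f g : T -> R) : measurable K ->
  (forall a, measurable (K `&` [set t | f t <= a])) ->
  measurable_fun setT g -> (forall t, ~ K t -> f t = g t) ->
  measurable_fun setT f.
Proof.
move=> mK mfK mg fg; apply: measurable_fun_le_set => a.
rewrite [X in measurable X](_ : _ = (K `&` [set t | f t <= a]) `|`
    (~` K `&` [set t | g t <= a])).
  apply: measurableU => //; apply: measurable_fun_le => //.
  - exact: measurableC.
  - exact: measurable_funS mg.
apply/seteqP; split=> t /=.
  by have [Kt|Kt] := pselect (K t); [left|right; rewrite -fg].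
by move=> [[]//|[/fg ->]].
Qed.

Section DispatchStar.
Context {R : realType} {N M : nat}.
Variables (net : network R N M) (c : 'I_N -> R -> R -> R).
Hypothesis hc : cost_assumption c.
Hypothesis hr : forall e, 0 < resistance net e.

Implicit Types (p : N.-tuple R * N.-tuple R) (u : 'rV[R]_(N + M)).

(** The supremum only provides dispatches with margins above any given negative number. Their
    shortfalls are arbitrarily small, and compactness yields a dispatch with none. *)
Lemma Gmargin_ge0_feasible p : nonneg_vec p.1 ->
  (0 <= Gmargin net p)%E -> exists x, dap_feasible net p x.
Proof.
move=> Q0 G0.
suff [u uc] : exists2 u, unit_cube R (N + M) u & shortfall net p u <= 0.
  by move=> /(shortfall_le0 net Q0 uc); exists (dispatch net p.1 u).
apply: unit_cube_le0; first exact: continuous_shortfall.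
(* Each of the [N] nodes may miss [e']; dividing by [N.+1] keeps the total strictly below [e]. *)
move=> e e0; pose e' := e / N.+1%:R.
have e'0 : 0 < e' by rewrite divr_gt0.
have : ((- e')%:E < Gmargin net p)%E.
  by apply: lt_le_trans G0; rewrite lte_fin oppr_lt0.
move=> /ereal_sup_gt[_ [x xbox <-] /ltW /bigmin_geP[_ xmargin]].
have [u uc ux] := in_box_dispatch Q0 xbox.
exists u => //.
apply: (@le_lt_trans _ _ (\sum_(i < N) e')).
  apply: ler_sum => i _; rewrite ux ge_max (ltW e'0)/=.
  have := xmargin i isT; rewrite lee_fin /net_inflow /edge_inflow; lra.
rewrite sumr_const card_ord -mulr_natr /e' mulrAC ltr_pdivrMr// ltr_pM2l//.
by rewrite ltr_nat.
Qed.

Lemma feasible_Gmargin_ge0 p x : dap_feasible net p x -> (0 <= Gmargin net p)%E.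
Proof.
move=> [xf xbox]; apply: le_trans (ereal_sup_ubound _); last by exists x.
apply: le_bigmin => [|i _]; first exact: leey.
by rewrite lee_fin sumrB; have := xf i; lra.
Qed.

(** The supremum in [Gmargin] becomes an existence over the cube, to which [measurable_exists_le0]
    applies. *)
Lemma KsetE p : Kset net p <->
  [/\ nonneg_vec p.1, nonneg_vec p.2 &
      exists2 u, unit_cube R (N + M) u & shortfall net p u <= 0].
Proof.
split=> -[Q0 D0]; last first.
  move=> [u uc /(shortfall_le0 net Q0 uc) uf]; split=> //.
  exact: feasible_Gmargin_ge0 uf.
move=> /(Gmargin_ge0_feasible Q0)[x [xf xbox]]; split=> //.
have [u uc ux] := in_box_dispatch Q0 xbox.
by exists u => //; apply/shortfall_le0; rewrite ?ux.
Qed.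

(** The budget [t] has three uses: the infimum of the costs, for existence; a constant, for the
    sublevel sets of the value; the value itself, to single out the solutions measurably in [p]. *)
Definition penalty p t u : R :=
  shortfall net p u + Num.max 0 (dispatch_cost net c p.1 u - t).

Lemma continuous_penalty p t : continuous (penalty p t).
Proof.
apply: continuous_add; first exact: continuous_shortfall.
apply: continuous_max0; apply: continuous_sub; last exact: cst_continuous.
exact: continuous_dispatch_cost.
Qed.

Lemma measurable_penalty (t : N.-tuple R * N.-tuple R -> R) u :
  measurable_fun setT t -> measurable_fun setT (fun p => penalty p (t p) u).
Proof.
move=> mt; apply: measurable_funD; first exact: measurable_shortfall.
apply: measurable_maxr => //; apply: measurable_funB => //.
exact: measurable_dispatch_cost.
Qed.

Lemma penalty_ge0 p t u : 0 <= penalty p t u.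
Proof. by rewrite addr_ge0 ?shortfall_ge0// le_max lexx. Qed.

Lemma penalty_le0 p t u : nonneg_vec p.1 -> unit_cube R (N + M) u ->
  (penalty p t u <= 0) <->
  dap_feasible net p (dispatch net p.1 u) /\
  dap_cost c p.1 (dispatch net p.1 u).1 <= t.
Proof.
move=> Q0 uc; rewrite -(shortfall_le0 net Q0 uc) -(dispatch_costE _ _ Q0 uc).
have s0 := shortfall_ge0 net p u.
have m0 : 0 <= Num.max 0 (dispatch_cost net c p.1 u - t) by rewrite le_max lexx.
split=> [H|[H1 H2]].
  split; first by move: H; rewrite /penalty; lra.
  rewrite -subr_le0.
  apply: (@le_trans _ _ (Num.max 0 (dispatch_cost net c p.1 u - t))).
    by rewrite le_max lexx orbT.
  by move: H; rewrite /penalty; lra.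
rewrite /penalty (max_idPl _); first lra.
by rewrite subr_le0.
Qed.

Lemma dap_cost_ge0 (Q q : N.-tuple R) : nonneg_vec Q -> nonneg_vec q ->
  0 <= dap_cost c Q q.
Proof. by move=> Q0 q0; apply: sumr_ge0 => i _; have [+ _] := hc i; apply. Qed.

(** Almost optimal dispatches make the penalty at level [inf costs] arbitrarily small; by
    compactness it vanishes at some dispatch, which is then feasible and optimal. *)
Lemma dap_solution_exists p : nonneg_vec p.1 ->
  (exists x, dap_feasible net p x) -> exists x, dap_solution net c p x.
Proof.
move=> Q0 [x0 x0f].
pose costs := [set dap_cost c p.1 x.1 | x in [set x | dap_feasible net p x]].
have costs_inf : has_inf costs.
  split; first by exists (dap_cost c p.1 x0.1), x0.
  exists 0 => _ [x [_ [xq _]] <-]; apply: dap_cost_ge0 => // i.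
  by case/andP: (xq i).
have [u uc] : exists2 u, unit_cube R (N + M) u & penalty p (inf costs) u <= 0.
  apply: unit_cube_le0; first exact: continuous_penalty.
  move=> e e0; have [_ [x xf <-] xlt] := inf_adherent e0 costs_inf.
  have [u uc ux] := in_box_dispatch Q0 xf.2.
  exists u => //; rewrite /penalty (dispatch_costE _ _ Q0 uc) ux.
  have s0 : shortfall net p u <= 0 by apply/shortfall_le0; rewrite ?ux.
  have m0 : Num.max 0 (dap_cost c p.1 x.1 - inf costs) < e.
    by rewrite gt_max e0/= ltrBlDl.
  by move: s0 m0; lra.
move=> /(penalty_le0 _ Q0 uc)[uf ucost]; exists (dispatch net p.1 u).
split=> // y yf; apply: le_trans ucost _; apply: ge_inf; first by case: costs_inf.
by exists y.
Qed.

(** * Measurability of the value and of the solution *)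

Section Star.
Variable ext : N.-tuple R * N.-tuple R -> N.-tuple R * M.-tuple R.
Hypothesis mext : measurable_fun setT ext.

Let star := dap_star net c ext.

Lemma dap_star_solution p : Kset net p -> dap_solution net c p (star p).
Proof.
move=> Kp; rewrite /star /dap_star asboolT//.
apply: (@xgetPex _ _ [set x | dap_solution net c p x]).
case: Kp => Q0 D0 /(Gmargin_ge0_feasible Q0); exact: dap_solution_exists.
Qed.

Lemma dap_star_ext p : ~ Kset net p -> star p = ext p.
Proof. by move=> Kp; rewrite /star /dap_star asboolF. Qed.

Lemma measurable_nonneg_vec d (T : measurableType d) n (f : T -> n.-tuple R) :
  measurable_fun setT f -> measurable [set t | nonneg_vec (f t)].
Proof.
move=> /measurable_fun_tnthP mf.
rewrite [X in measurable X](_ : _ =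
    \bigcap_(i in [set: 'I_n]) [set t | 0 <= tnth (f t) i]).
  apply: fin_bigcap_measurable => // i _.
  rewrite -[X in measurable X]setTI; apply: measurable_fun_le => //.
  exact: mf.
by apply/seteqP; split=> t /= H; [move=> i _|move=> i]; apply: H.
Qed.

Lemma measurable_Kset : measurable (Kset net).
Proof.
rewrite [X in measurable X](_ : _ =
    [set p | nonneg_vec p.1] `&` [set p | nonneg_vec p.2] `&`
    [set p | exists2 u, unit_cube R (N + M) u & shortfall net p u <= 0]).
  apply: measurableI; first by apply: measurableI; exact: measurable_nonneg_vec.
  apply: measurable_exists_le0 => [p|u].
    exact: continuous_shortfall.
  exact: measurable_shortfall.
apply/seteqP; split=> p /=; first by move=> /KsetE[].
by move=> [[? ?] ?]; apply/KsetE.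
Qed.

Definition dap_value p : R :=
  if `[< Kset net p >] then dap_cost c p.1 (star p).1 else 0.

Lemma dap_valueE p : Kset net p -> dap_value p = dap_cost c p.1 (star p).1.
Proof. by move=> Kp; rewrite /dap_value asboolT. Qed.

(** As the minimum is attained, the value on [Kset] is at most [a] exactly when some feasible
    dispatch costs at most [a]. *)
Lemma measurable_dap_value : measurable_fun setT dap_value.
Proof.
apply: (@measurable_patch _ _ _ (Kset net) _ (cst 0)) => [|a||p Kp] //.
- exact: measurable_Kset.
- rewrite [X in measurable X](_ : _ = Kset net `&`
    [set p | exists2 u, unit_cube R (N + M) u & penalty p a u <= 0]).
    apply: measurableI; first exact: measurable_Kset.
    apply: measurable_exists_le0 => [p|u]; first exact: continuous_penalty.
    exact: measurable_penalty.
  apply/seteqP; split=> p /= [Kp]; have [Q0 D0 _] := Kp;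
    have [sf smin] := dap_star_solution Kp.
    rewrite dap_valueE// => va; split=> //.
    have [u uc us] := in_box_dispatch Q0 sf.2.
    by exists u => //; apply/penalty_le0; rewrite ?us.
  move=> [u uc /(penalty_le0 _ Q0 uc)[uf ucost]]; split=> //.
  by rewrite dap_valueE//; apply: le_trans (smin _ uf) ucost.
- by rewrite /dap_value asboolF.
Qed.

(* By uniqueness, a coordinate of the solution is at most [a] iff some feasible
   dispatch has optimal cost and this coordinate at most [a]. *)
Lemma measurable_dap_star_coord (coord : N.-tuple R * M.-tuple R -> R) :
  (forall p, continuous (fun u => coord (dispatch net p.1 u))) ->
  (forall u, measurable_fun setT (fun p => coord (dispatch net p.1 u))) ->
  measurable_fun setT (coord \o ext) ->
  measurable_fun setT (coord \o star).
Proof.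
move=> cont_coord meas_coord mcext.
apply: (@measurable_patch _ _ _ (Kset net) _ (coord \o ext)) => [|a||p Kp] //.
- exact: measurable_Kset.
- pose h p u := penalty p (dap_value p) u +
    Num.max 0 (coord (dispatch net p.1 u) - a).
  rewrite [X in measurable X](_ : _ = Kset net `&`
    [set p | exists2 u, unit_cube R (N + M) u & h p u <= 0]).
    apply: measurableI; first exact: measurable_Kset.
    apply: measurable_exists_le0 => [p|u].
      apply: continuous_add; first exact: continuous_penalty.
      by apply: continuous_max0; apply: continuous_sub => //; exact: cst_continuous.
    apply: measurable_funD.
      by apply: measurable_penalty; exact: measurable_dap_value.
    by apply: measurable_maxr => //; exact: measurable_funB.
  apply/seteqP; split=> p /= [Kp]; have [Q0 D0 _] := Kp;
    have ss := dap_star_solution Kp; have [sf smin] := ss.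
    move=> sa; split=> //.
    have [u uc us] := in_box_dispatch Q0 sf.2.
    exists u => //; rewrite /h us (max_idPl _) ?subr_le0// addr0.
    by apply/penalty_le0; rewrite ?us ?dap_valueE.
  move=> [u uc hu]; split=> //.
  have pen0 := penalty_ge0 p (dap_value p) u.
  have m0 : 0 <= Num.max 0 (coord (dispatch net p.1 u) - a) by rewrite le_max lexx.
  have [uf ucost] : dap_feasible net p (dispatch net p.1 u) /\
      dap_cost c p.1 (dispatch net p.1 u).1 <= dap_value p.
    by apply/penalty_le0 => //; move: hu; rewrite /h; lra.
  have -> : star p = dispatch net p.1 u.
    apply: (dap_solution_unique hc hr Q0 D0 ss); split=> // y /smin.
    by apply: le_trans; rewrite -dap_valueE.
  rewrite -subr_le0.
  apply: (@le_trans _ _ (Num.max 0 (coord (dispatch net p.1 u) - a))).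
    by rewrite le_max lexx orbT.
  by move: hu; rewrite /h; lra.
- by rewrite /= dap_star_ext.
Qed.

Lemma measurable_dap_star : measurable_fun setT star.
Proof.
have /measurable_fun_pairP[me1 me2] := mext.
apply/measurable_fun_pairP; split; apply/measurable_fun_tnthP => i.
- apply: (@measurable_dap_star_coord (fun x => tnth x.1 i)).
  + by move=> p; exact: continuous_dispatch_q.
  + by move=> u; exact: measurable_dispatch_q.
  + exact: ((measurable_fun_tnthP _).1 me1).
- apply: (@measurable_dap_star_coord (fun x => tnth x.2 i)).
  + by move=> p; exact: continuous_dispatch_phi.
  + by move=> u; rewrite /dispatch/=; exact: measurable_cst.
  + exact: ((measurable_fun_tnthP _).1 me2).
Qed.

End Star.
End DispatchStar.

(** * Processes and integrals *)

Section NullSetIntegral.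
Context d (T : measurableType d) (R : realType) (mu : {measure set T -> \bar R}).
Variable Z : set T.
Hypotheses (mZ : measurable Z) (muZ : mu Z = 0%E).

Import HBNNSimple.

(* Neither function need be measurable: the integral of a nonnegative function
   is a supremum over simple functions, which may be cut off on [Z]. *)
Lemma le_integral_off_null (f g : T -> \bar R) :
  (forall x, 0 <= f x)%E -> (forall x, 0 <= g x)%E ->
  (forall x, ~ Z x -> f x = g x) -> (\int[mu]_x f x <= \int[mu]_x g x)%E.
Proof.
move=> f0 g0 fg; rewrite !ge0_integralTE//; apply: ge_ereal_sup => _ [h /= hf <-].
pose k := mul_nnsfun h (indic_nnsfun R (measurableC mZ)).
have kE x : k x = h x * \1_(~` Z) x by [].
apply: ereal_sup_ubound; exists k.
  move=> x; rewrite kE indicE; have [Zx|Zx] := pselect (Z x).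
    by rewrite memNset ?mulr0//= => /(_ Zx).
  by rewrite mem_set// mulr1 -fg.
rewrite -!integralT_nnsfun; apply: ge0_ae_eq_integral => //.
- exact/measurable_EFinP.
- exact/measurable_EFinP.
- by move=> x _; rewrite lee_fin.
- by move=> x _; rewrite lee_fin.
exists Z; split=> // x /= H; apply: contrapT => Zx; apply: H => _.
transitivity (h x * \1_(~` Z) x)%:E => //.
by rewrite indicE mem_set// mulr1.
Qed.

Lemma eq_integral_off_null (f g : T -> \bar R) :
  (forall x, ~ Z x -> f x = g x) -> (\int[mu]_x f x = \int[mu]_x g x)%E.
Proof.
move=> fg; rewrite integralE [RHS]integralE.
congr (_ - _)%E; apply/eqP; rewrite eq_le; apply/andP; split;
  by apply: le_integral_off_null => // x Zx; rewrite ?funeposE ?funenegE fg.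
Qed.

End NullSetIntegral.

(** * Predictable processes *)

Section PredictableProcesses.
Context {R : realType} {d : measure_display} {Omega : measurableType d}.
Variables (T : R) (F : R -> set (set Omega)).
Hypothesis T0 : 0 <= T.
Hypothesis hF : filtration T F.

Lemma predictable_comp d1 d2 (V : measurableType d1) (W : measurableType d2)
    (g : V -> W) (X : R -> Omega -> V) :
  measurable_fun setT g -> predictable T F X ->
  predictable T F (fun s w => g (X s w)).
Proof.
move=> mg pX B mB; apply: (pX (g @^-1` B)).
by rewrite -[X in measurable X]setTI; exact: mg.
Qed.

(** The sets with predictable preimage form a sigma-algebra containing the preimages under both
    projections, which generate the product one. *)
Lemma predictable_pair d1 d2 (V : measurableType d1) (W : measurableType d2)
    (X : R -> Omega -> V) (Y : R -> Omega -> W) :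
  predictable T F X -> predictable T F Y ->
  predictable T F (fun s w => (X s w, Y s w)).
Proof.
move=> pX pY B; pose D : set (R * Omega) := `[0, T]%classic `*` setT.
have [s0 sC sU] : sigma_algebra D (predictable_sets T F).
  exact: smallest_sigma_algebra.
pose C := [set B : set (V * W) | predictable_sets T F
  [set z | 0 <= z.1 <= T /\ B (X z.1 z.2, Y z.1 z.2)]].
suff : <<s preimage_set_system setT (@fst V W) measurable `|`
           preimage_set_system setT (@snd V W) measurable >> `<=` C by exact.
apply: smallest_sub => [|_ [] [A mA <-]]; last 2 first.
- rewrite /C setTI; exact: pX.
- rewrite /C setTI; exact: pY.
split.
- rewrite /C /= [X in predictable_sets _ _ X](_ : _ = set0)//.
  by apply/seteqP; split=> z //= [].
- move=> A CA; rewrite /C /= [X in predictable_sets _ _ X](_ : _ = D `\`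
      [set z | 0 <= z.1 <= T /\ A (X z.1 z.2, Y z.1 z.2)]); first exact: sC.
  apply/seteqP; split=> z; rewrite /D/= in_itv/=.
    by move=> [zT [_ H]]; split; [split|move=> []].
  by move=> [[zT _] H]; split=> //; split=> // ?; apply: H.
- move=> A CA; rewrite /C /= [X in predictable_sets _ _ X](_ : _ = \bigcup_k
      [set z | 0 <= z.1 <= T /\ A k (X z.1 z.2, Y z.1 z.2)]); first exact: sU.
  apply/seteqP; split=> z /=.
    by move=> [zT [k _ Ak]]; exists k.
  by move=> [k _ [zT Ak]]; split=> //; exists k.
Qed.

(** The generators are products of a point or an interval with an event of some [F t]. This brings
    predictable processes under the product measure. *)
Lemma predictable_measurable B : predictable_sets T F B -> measurable B.
Proof.
have [hFt _] := hF.
have mD : measurable (`[0, T]%classic `*` [set: Omega]) by exact: measurableX.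
suff H : predictable_sets T F `<=` measurable by exact: H.
apply: smallest_sub.
  split=> // [A mA|A mA]; first exact: measurableD.
  exact: bigcupT_measurable.
move=> _ [[A FA ->]|[s [t [A [s0 st tT FA ->]]]]].
  apply: measurableX; first exact: measurable_set1.
  by have [_] := hFt 0 (introT andP (conj (lexx _) T0)); apply.
apply: measurableX => //.
have sT : 0 <= s <= T by rewrite s0 (le_trans (ltW st)).
by have [_] := hFt s sT; apply.
Qed.

Lemma predictable_measurable_fun d1 (V : measurableType d1) (X : R -> Omega -> V) :
  predictable T F X ->
  measurable_fun (`[0, T]%classic `*` setT) (fun z : R * Omega => X z.1 z.2).
Proof.
move=> pX mD B mB; have := predictable_measurable (pX B mB).
congr (measurable _); apply/seteqP; split=> z /=; rewrite in_itv/=.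
  by move=> [? ?].
by move=> [[? _] ?].
Qed.

End PredictableProcesses.

Lemma measurable_eq_tuple d (S : measurableType d) (R : realType) n (A : set S)
    (f g : S -> n.-tuple R) : measurable A ->
  measurable_fun A f -> measurable_fun A g ->
  measurable (A `&` [set t | f t = g t]).
Proof.
move=> mA mf mg.
rewrite [X in measurable X](_ : _ = A `&` \bigcap_(i in [set: 'I_n])
    (A `&` (fun t => tnth (f t) i == tnth (g t) i) @^-1` [set true])).
  apply: measurableI => //; apply: fin_bigcap_measurable => // i _.
  apply: measurable_fun_eqr => //.
  - exact: (measurableT_comp (measurable_tnth i)).
  - exact: (measurableT_comp (measurable_tnth i)).
apply/seteqP; split=> t /= [At H]; split=> //.
  by move=> i _; split=> //=; rewrite H eqxx.
by apply: eq_from_tnth => i; apply/eqP; have [_] := H i I.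
Qed.

Lemma uniform_prob_itv (R : realType) (a b : R) (ab : a < b) :
  uniform_prob ab `[a, b]%classic = 1%E.
Proof. exact: integral_uniform_pdf1. Qed.

(** * The cost of a process as an integral over time and events *)

Section StochasticDispatch.
Context {R : realType} {N M : nat}.
Variables (net : network R N M) (c : 'I_N -> R -> R -> R).
Hypothesis hc : cost_assumption c.
Hypothesis hr : forall e, 0 < resistance net e.
Context {d : measure_display} {Omega : measurableType d}.
Variables (P : probability Omega R) (T : R).
Hypothesis hT : 0 < T.
Variable F : R -> set (set Omega).
Hypothesis hF : filtration T F.
Variables (Q D : R -> Omega -> N.-tuple R).
Hypotheses (pQ : predictable T F Q) (pD : predictable T F D).
Hypothesis Q0 : forall (s : R) w, 0 <= s <= T -> nonneg_vec (Q s w).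
Hypothesis D0 : forall (s : R) w, 0 <= s <= T -> nonneg_vec (D s w).
Variable ext : N.-tuple R * N.-tuple R -> N.-tuple R * M.-tuple R.
Hypothesis mext : measurable_fun setT ext.
Hypothesis hG : always_feasible P T net Q D.

Let mu := (uniform_prob hT \x P)%E.
Let horizon : set (R * Omega) := `[0, T]%classic `*` setT.
Let star s w := dap_star net c ext (Q s w, D s w).
Implicit Types (x y : R -> Omega -> N.-tuple R * M.-tuple R).

Lemma horizonE s w : horizon (s, w) = (0 <= s <= T) :> Prop.
Proof. by apply/propext; split=> [[]|]; rewrite /horizon/= in_itv. Qed.

Lemma measurable_horizon : measurable horizon.
Proof. exact: measurableX. Qed.

Lemma mu_setC (A : set (R * Omega)) : measurable A -> mu (~` A) = (1 - mu A)%E.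
Proof. by move=> mA; rewrite -(probability_setC (uniform_prob hT \x P)%E mA). Qed.

Lemma mu_horizonC : mu (~` horizon) = 0%E.
Proof.
have muH : mu horizon = 1%E.
  transitivity (uniform_prob hT `[0%R, T]%classic * P setT)%E.
    exact: product_measure1E.
  by rewrite uniform_prob_itv probability_setT mule1.
by rewrite mu_setC ?muH ?subee//; exact: measurable_horizon.
Qed.

(* The running cost, set to [0] on the null set [Z] where the processes are
   unconstrained and the integrand need not even be measurable. *)
Definition running_cost (Z : set Omega) x : R * Omega -> R :=
  (fun z => dap_cost c (Q z.1 z.2) (x z.1 z.2).1) \_ (`[0, T]%classic `*` ~` Z).

(** A single null set gathers the exceptional events of the assumption on [(Q, D)] and of the
    constraints on [x]. *)
Definition feasible_off (Z : set Omega) x :=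
  [/\ measurable Z, P Z = 0%E & forall w s, ~ Z w -> 0 <= s <= T ->
    Kset net (Q s w, D s w) /\ dap_feasible net (Q s w, D s w) (x s w)].

Lemma running_costE Z x s w : 0 <= s <= T -> ~ Z w ->
  running_cost Z x (s, w) = dap_cost c (Q s w) (x s w).1.
Proof.
by move=> sT Zw; rewrite /running_cost patchT// inE/=; split=> //=; rewrite in_itv.
Qed.

Lemma running_cost0 Z x s w : ~ (0 <= s <= T /\ ~ Z w) ->
  running_cost Z x (s, w) = 0.
Proof.
move=> H; rewrite /running_cost patchC// inE/= => -[]; rewrite /= in_itv/= => ? ?.
exact: H.
Qed.

Lemma running_cost_ge0 Z x z : feasible_off Z x -> 0 <= running_cost Z x z.
Proof.
case: z => s w [_ _ xf].
have [[sT Zw]|H] := pselect (0 <= s <= T /\ ~ Z w); last by rewrite running_cost0.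
rewrite running_costE//; have [_ [_ [xq _]]] := xf _ _ Zw sT.
by apply: (dap_cost_ge0 hc); [exact: Q0|move=> i; case/andP: (xq i)].
Qed.

Lemma measurable_running_cost Z x : predictable T F x -> feasible_off Z x ->
  measurable_fun setT (running_cost Z x).
Proof.
move=> px [mZ _ xf]; pose H0 : set (R * Omega) := `[0, T]%classic `*` ~` Z.
have mH0 : measurable H0 by apply: measurableX => //; exact: measurableC.
have mx := predictable_measurable_fun (ltW hT) hF px.
have mQ := predictable_measurable_fun (ltW hT) hF pQ.
apply/(measurable_restrictT _ _).1 => //.
(* The processes are known to be measurable only on the horizon, so their coordinates are extended
   by 0. *)
pose q i := (fun z : R * Omega => tnth (x z.1 z.2).1 i) \_ horizon.
pose Qi i := (fun z : R * Omega => tnth (Q z.1 z.2) i) \_ horizon.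
have mq i : measurable_fun setT (q i).
  apply/(measurable_restrictT _ _).1; first exact: measurable_horizon.
  apply: (measurableT_comp (measurable_tnth i)).
  exact: (measurableT_comp measurable_fst mx).
have mQi i : measurable_fun setT (Qi i).
  apply/(measurable_restrictT _ _).1; first exact: measurable_horizon.
  exact: (measurableT_comp (measurable_tnth i) mQ).
(* Off [Z] and within the horizon all arguments are nonnegative, so [abs_cost] is the cost
   itself. *)
apply: (@eq_measurable_fun _ _ _ _ _
    (fun z => \sum_i abs_cost c i (q i z) (Qi i z))).
  move=> [s w]; rewrite inE => -[/=]; rewrite in_itv/= => sT Zw.
  have [_ [_ [xq _]]] := xf _ _ Zw sT.
  apply: eq_bigr => i _; rewrite /abs_cost /q /Qi !patchT ?inE ?horizonE//=.
  rewrite !ger0_norm//; first exact: Q0.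
  by case/andP: (xq i).
apply: measurable_funTS; apply: measurable_sum => i.
by apply: measurable_caratheodory => //;
  [exact: continuous_abs_cost|exact: measurable_abs_cost].
Qed.

(** This is Tonelli's theorem; the factor [T] undoes the normalization of the uniform law on
    [[0, T]]. *)
Lemma pnu_costE Z x : predictable T F x -> feasible_off Z x ->
  pnu_cost P T c Q x = (T%:E * \int[mu]_z (running_cost Z x z)%:E)%E.
Proof.
move=> px xf; have [mZ PZ _] := xf.
have mf : measurable_fun setT (EFin \o running_cost Z x).
  by apply/measurable_EFinP; exact: measurable_running_cost.
have f0 z : (0 <= (EFin \o running_cost Z x) z)%E.
  by rewrite /= lee_fin; exact: running_cost_ge0.
have mG := @measurable_fun_fubini_tonelli_G _ _ _ _ _ (uniform_prob hT) _ mf f0.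
have -> : (\int[mu]_z (running_cost Z x z)%:E =
    \int[P]_w fubini_G (uniform_prob hT) (EFin \o running_cost Z x) w)%E.
  exact: fubini_tonelli2.
rewrite -(ge0_integralZl _ _ mG)//; last 2 first.
- by move=> w _; apply: integral_ge0 => s _.
- by rewrite lee_fin ltW.
(* The inner integrals are compared only outside [Z]; the one in [pnu_cost] is not known to be
   measurable in [w]. *)
rewrite /pnu_cost; apply: (eq_integral_off_null mZ PZ) => w Zw.
rewrite /fubini_G integral_uniform//; last exact: measurable_fun_pair1.
rewrite subr0 muleA -EFinM mulfV ?gt_eqF// mul1e.
by apply: eq_integral => s; rewrite inE/= in_itv/= => sT; rewrite running_costE.
Qed.

(** * Optimality of the process of day-ahead solutions *)

Lemma predictable_star : predictable T F star.
Proof.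
apply: (predictable_comp (X := fun s w => (Q s w, D s w))).
  exact: measurable_dap_star.
exact: predictable_pair.
Qed.

Lemma feasible_off_star Z x : feasible_off Z x -> feasible_off Z star.
Proof.
move=> [mZ PZ xf]; split=> // w s Zw sT; have [Kp _] := xf _ _ Zw sT.
by split=> //; case: (dap_star_solution hc ext Kp).
Qed.

Lemma exists_feasible_off x :
  {ae P, forall w, forall s, 0 <= s <= T ->
    dap_feasible net (Q s w, D s w) (x s w)} -> exists Z, feasible_off Z x.
Proof.
move: hG => [A [mA PA subA]] [B [mB PB subB]].
exists (A `|` B); split=> [||w s /not_orP[Aw Bw] sT].
- exact: measurableU.
- by apply: null_set_setU.
split.
  split; [exact: Q0|exact: D0|].
  by apply: contrapT => H; apply: Aw; apply: subA => /(_ s sT).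
by apply: contrapT => H; apply: Bw; apply: subB => /(_ s sT).
Qed.

Lemma pnu_feasible_star : pnu_feasible P T F net Q D star.
Proof.
split; first exact: predictable_star.
move: hG => [A [mA PA subA]]; exists A; split=> // w H; apply: subA => HA; apply: H.
move=> s sT; have Kp : Kset net (Q s w, D s w).
  by split; [exact: Q0|exact: D0|exact: HA].
by have [] := dap_star_solution hc ext Kp.
Qed.

Lemma running_cost_star_le Z x z : feasible_off Z x ->
  running_cost Z star z <= running_cost Z x z.
Proof.
case: z => s w [_ _ xf].
have [[sT Zw]|H] := pselect (0 <= s <= T /\ ~ Z w); last by rewrite !running_cost0.
rewrite !running_costE//; have [Kp xfeas] := xf _ _ Zw sT.
by have [_] := dap_star_solution hc ext Kp; apply.
Qed.

Lemma pnu_cost_star_le x : pnu_feasible P T F net Q D x ->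
  (pnu_cost P T c Q star <= pnu_cost P T c Q x)%E.
Proof.
move=> [px /exists_feasible_off[Z xf]].
have sf := feasible_off_star xf.
rewrite (pnu_costE px xf) (pnu_costE predictable_star sf).
apply: lee_wpmul2l; first by rewrite lee_fin ltW.
apply: ge0_le_integral => //.
- by move=> z _; rewrite lee_fin; exact: running_cost_ge0.
- by apply/measurable_EFinP; exact: (measurable_running_cost predictable_star).
- by apply/measurable_EFinP; exact: measurable_running_cost.
- by move=> z _; rewrite lee_fin; exact: running_cost_star_le.
Qed.

Lemma pnu_optimal_star : pnu_optimal P T F net c Q D star.
Proof. by split; [exact: pnu_feasible_star|exact: pnu_cost_star_le]. Qed.

Lemma pnu_value_star : pnu_value P T F net c Q D = pnu_cost P T c Q star.
Proof.
apply/eqP; rewrite eq_le; apply/andP; split.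
  by apply: ereal_inf_lbound; exists star => //; exact: pnu_feasible_star.
by apply: le_ereal_inf_tmp => _ [x xf <-]; exact: pnu_cost_star_le.
Qed.

(** * Almost everywhere agreement with the day-ahead solution *)

Let agreement x : set (R * Omega) :=
  [set z | 0 <= z.1 <= T /\ x z.1 z.2 = star z.1 z.2].

Lemma measurable_agreement x : predictable T F x -> measurable (agreement x).
Proof.
move=> px; have mx := predictable_measurable_fun (ltW hT) hF px.
have ms := predictable_measurable_fun (ltW hT) hF predictable_star.
rewrite [X in measurable X](_ : _ =
  (horizon `&` [set z | (x z.1 z.2).1 = (star z.1 z.2).1]) `&`
  (horizon `&` [set z | (x z.1 z.2).2 = (star z.1 z.2).2])).
  apply: measurableI; apply: measurable_eq_tuple;
    try exact: measurable_horizon.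
  - exact: (measurableT_comp measurable_fst mx).
  - exact: (measurableT_comp measurable_fst ms).
  - exact: (measurableT_comp measurable_snd mx).
  - exact: (measurableT_comp measurable_snd ms).
apply/seteqP; split=> -[s w] /=; rewrite horizonE.
  by move=> [sT ->].
move=> [[sT x1] [_ x2]]; split=> //.
by case: (x s w) (star s w) x1 x2 => [? ?] [? ?] /= -> ->.
Qed.

Lemma pnu_cost_agreement x : pnu_feasible P T F net Q D x ->
  mu (agreement x) = 1%E -> pnu_cost P T c Q x = pnu_cost P T c Q star.
Proof.
move=> [px /exists_feasible_off[Z xf]] x1.
have sf := feasible_off_star xf.
rewrite (pnu_costE px xf) (pnu_costE predictable_star sf); congr (_ * _)%E.
have mA := measurable_agreement px.
apply: (@eq_integral_off_null _ _ _ (uniform_prob hT \x P)%E (~` agreement x)).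
- exact: measurableC.
- by transitivity (1 - mu (agreement x))%E; [exact: mu_setC|rewrite x1 subee].
move=> [s w] /contrapT[/= sT xs].
have [Zw|Zw] := pselect (Z w); first by rewrite !running_cost0// => -[].
by rewrite !running_costE// xs.
Qed.

(** The running cost of [x] is nowhere below that of [star], and their integrals are equal and
    finite. So the gap vanishes almost everywhere, where [x] then solves (DAP) and uniqueness
    applies. *)
Lemma agreement_optimal x : pnu_optimal P T F net c Q D x ->
  (pnu_value P T F net c Q D < +oo)%E -> mu (agreement x) = 1%E.
Proof.
move=> [[px ae_xf] xmin] Voo; have [Z xf] := exists_feasible_off ae_xf.
have sf := feasible_off_star xf.
have mA := measurable_agreement px.
have mcx := measurable_running_cost px xf.
have mcs := measurable_running_cost predictable_star sf.
pose gap z := running_cost Z x z - running_cost Z star z.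
have gap0 z : 0 <= gap z by rewrite subr_ge0; exact: running_cost_star_le.
have mgap : measurable_fun setT gap by exact: measurable_funB.
have cost_eq : (T%:E * \int[mu]_z (running_cost Z x z)%:E =
    T%:E * \int[mu]_z (running_cost Z star z)%:E)%E.
  rewrite -(pnu_costE px xf) -(pnu_costE predictable_star sf).
  apply/eqP; rewrite eq_le pnu_cost_star_le// andbT.
  exact: xmin pnu_feasible_star.
have int_eq : (\int[mu]_z (running_cost Z x z)%:E =
    \int[mu]_z (running_cost Z star z)%:E)%E.
  have := congr1 (fun e => (T^-1)%:E * e)%E cost_eq.
  by rewrite !muleA -!EFinM mulVf ?gt_eqF// !mul1e.
(* An infinite integral would make the value infinite, as [T] is positive. *)
have int_fin : (\int[mu]_z (running_cost Z star z)%:E)%E \is a fin_num.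
  rewrite ge0_fin_numE; last first.
    by apply: integral_ge0 => z _; rewrite lee_fin; exact: running_cost_ge0.
  rewrite ltey; apply/negP => /eqP Ioo; move: Voo.
  by rewrite pnu_value_star (pnu_costE predictable_star sf) Ioo gt0_muley// lte_fin.
have gap_int : (\int[mu]_z (gap z)%:E = 0)%E.
  move: int_eq; rewrite (_ : (fun z => (running_cost Z x z)%:E) =
    (fun z => (running_cost Z star z)%:E + (gap z)%:E)%E); last first.
    by apply/funext => z; rewrite -EFinD /gap addrC subrK.
  rewrite ge0_integralD//=.
  - rewrite addeC => /(congr1
      (fun e => e - \int[mu]_z (running_cost Z star z)%:E)%E).
    by rewrite addeK// subee.
  - by move=> z _; rewrite lee_fin; exact: running_cost_ge0.
  - exact/measurable_EFinP.
  - by move=> z _; rewrite lee_fin.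
  - exact/measurable_EFinP.
have [W [mW muW subW]] : ae_eq mu setT (EFin \o gap) (cst 0%E).
  apply/ae_eq_integral_abs => //; first exact/measurable_EFinP.
  by rewrite -gap_int; apply: eq_integral => z _ /=; rewrite ger0_norm.
have negA : (uniform_prob hT \x P)%E.-negligible (~` agreement x).
  (* Disagreement is confined to three null sets: nonzero gap, times outside the horizon, and the
     event [Z]. *)
  apply: (@negligibleS _ _ _ _ (W `|` (~` horizon `|` setT `*` Z))).
    move=> [s w] /= Axs; apply: contrapT => /not_orP[Ww /not_orP[]].
    move=> /contrapT; rewrite horizonE => sT Zw.
    have {}Zw : ~ Z w by move=> H; apply: Zw.
    apply: Axs; split=> //=.
    have gap_sw : gap (s, w) = 0.
      apply: contrapT => gsw; apply: Ww; apply: subW => /= H; apply: gsw.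
      by have [] := H I.
    have [_ _ /(_ _ _ Zw sT)[Kp xfeas]] := xf.
    have ss := dap_star_solution hc ext Kp.
    have [K1 K2 _] := Kp.
    apply: (dap_solution_unique hc hr K1 K2 _ ss); split=> // y yf.
    have [_ /(_ _ yf)] := ss; apply: le_trans.
    move: gap_sw; rewrite /gap !running_costE// => /eqP.
    by rewrite subr_eq0 => /eqP ->.
  have [mZ PZ _] := xf.
  apply: negligibleU; first by exists W; split.
  apply: negligibleU.
    exists (~` horizon); split; [|exact: mu_horizonC|by []].
    exact: measurableC measurable_horizon.
  exists (setT `*` Z); split=> //; first exact: measurableX.
  transitivity (uniform_prob hT setT * P Z)%E; first exact: product_measure1E.
  by rewrite PZ mule0.
have muAC : mu (~` agreement x) = 0%E.
  by apply: (measure_negligible _ negA); exact: measurableC.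
rewrite -(setCK (agreement x)) mu_setC; last exact: measurableC.
by rewrite [X in (_ - X)%E]muAC sube0.
Qed.

End StochasticDispatch.

(** The equivalence is stated for [V < +oo]: with an infinite value, every feasible process has
    infinite cost and is optimal. *)
Theorem proposition3p8 (R : realType) (N M : nat)
  (hN : (1 <= N)%N) (hM : (1 <= M)%N)
  (net : network R N M)
  (c : 'I_N -> R -> R -> R)
  (hc : cost_assumption c)
  (hr : forall e, 0 < resistance net e)
  (d : measure_display) (Omega : measurableType d) (P : probability Omega R)
  (T : R) (hT : 0 < T)
  (F : R -> set (set Omega)) (hF : filtration T F)
  (k : nat) (U : set (k.-tuple R)) (hU : compact_vec U)
  (Q D : (R -> Omega -> k.-tuple R) -> R -> Omega -> N.-tuple R)
  (hQ : forall nu, control T F U nu -> predictable T F (Q nu) /\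
          forall s w, 0 <= s <= T -> nonneg_vec (Q nu s w))
  (hD : forall nu, control T F U nu -> predictable T F (D nu) /\
          forall s w, 0 <= s <= T -> nonneg_vec (D nu s w))
  (ext : N.-tuple R * N.-tuple R -> N.-tuple R * M.-tuple R)
  (hext : measurable_fun [set: N.-tuple R * N.-tuple R] ext)
  (nu : R -> Omega -> k.-tuple R)
  (hnu : control T F U nu)
  (hnuG : always_feasible P T net (Q nu) (D nu)) :
  let star s w := dap_star net c ext (Q nu s w, D nu s w) in
  let V := pnu_value P T F net c (Q nu) (D nu) in
  let agrees_ae (x : R -> Omega -> N.-tuple R * M.-tuple R) :=
    (uniform_prob hT \x P)%E
      [set z | 0 <= z.1 <= T /\ x z.1 z.2 = star z.1 z.2] = 1%E in
  [/\ exists x, pnu_optimal P T F net c (Q nu) (D nu) x,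
      forall x, pnu_feasible P T F net (Q nu) (D nu) x ->
        (agrees_ae x -> pnu_optimal P T F net c (Q nu) (D nu) x) /\
        ((V < +oo)%E ->
           (pnu_optimal P T F net c (Q nu) (D nu) x <-> agrees_ae x)) &
      V = (\int[P]_w \int[lebesgue_measure]_(s in `[0%R, T])
             (\sum_(i < N) c i (tnth (star s w).1 i) (tnth (Q nu s w) i))%R%:E)%E].
Proof.
have [pQ Q0] := hQ nu hnu; have [pD D0] := hD nu hnu.
move=> star V agrees_ae.
have agrees_optimal x : pnu_feasible P T F net (Q nu) (D nu) x ->
    agrees_ae x -> pnu_optimal P T F net c (Q nu) (D nu) x.
  move=> xf xstar; split=> // y yf.
  rewrite (pnu_cost_agreement hc hr hF pQ pD Q0 D0 hext hnuG xf xstar).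
  exact: (pnu_cost_star_le hc hr hT hF pQ pD Q0 D0 hext hnuG yf).
split.
- by exists star; apply: pnu_optimal_star.
- move=> x xf; split=> [|Voo]; first exact: agrees_optimal.
  split; last exact: agrees_optimal.
  by move=> xo; apply: (agreement_optimal hc hr hT hF pQ pD Q0 D0 hext hnuG xo).
- exact: pnu_value_star.
Qed.
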